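(* Let $m\ge 1$ and let ${\cal N}^*_m$ be the connected component of ${\cal D}^*_m$ containing the word $0^m$. If $v\in V({\cal N}^*_m)$, then $\overline{v}\in V({\cal N}^*_m)$ and $\rho^k(v)\in V({\cal N}^*_m)$ for every $0\le k\le m-1$.
   Context: Alpha-letters (2-element subsets of the directions up, down, left, right): $a=\{\text{right},\text{down}\}$, $b=\{\text{up},\text{down}\}$, $c=\{\text{right},\text{up}\}$, $d=\{\text{left},\text{down}\}$, $e=\{\text{left},\text{right}\}$, $f=\{\text{left},\text{up}\}$. ${\cal D}_{ud}$: arc $(\alpha,\beta)$ iff ($\text{down}\in\alpha\iff\text{up}\in\beta$); ${\cal D}_{lr}$: arc $(\alpha,\beta)$ iff ($\text{right}\in\alpha\iff\text{left}\in\beta$). ${\cal D}_m$: vertices are the words $\alpha_1\cdots\alpha_m\in\{a,\dots,f\}^m$ with $(\alpha_i,\alpha_{i+1})$ an arc of ${\cal D}_{ud}$ for $1\le i\le m$ ($\alpha_{m+1}:=\alpha_1$); arc $v\to u$ iff $(v_i,u_i)$ is an arc of ${\cal D}_{lr}$ for all $i$. Outlet word $o(\alpha)\in\{0,1\}^m$: $o_j=1$ iff $\alpha_j\in\{a,c,e\}$; inlet word $i(\alpha)$: $i_j=1$ iff $\alpha_j\in\{d,e,f\}$. ${\cal D}^*_m$: vertex set $\{o(x):x\in V({\cal D}_m)\}$, number of arcs from $v$ to $w$ equal to $|\{y\in V({\cal D}_m): i(y)=v,\ o(y)=w\}|$. For a binary word $v=b_1\cdots b_m$: $\overline{v}=b_m\cdots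 b_1$ and $\rho(v)=b_2\cdots b_mb_1$, $\rho^k$ its $k$-th iterate ($\rho^0$ the identity). Connected components are those of the underlying undirected multigraph. *)

(* Defs.v *)
From HB Require Import structures.
From mathcomp Require Import all_boot.

Set Implicit Arguments.
Unset Strict Implicit.
Unset Printing Implicit Defensive.

Inductive dir := Up | Down | Left | Right.

Definition dir_code (x : dir) : bool * bool :=
  match x with
  | Up => (false, false) | Down => (false, true)
  | Left => (true, false) | Right => (true, true)
  end.

Definition dir_decode (p : bool * bool) : dir :=
  match p with
  | (false, false) => Up | (false, true) => Down
  | (true, false) => Left | (true, true) => Right
  end.

Lemma dir_codeK : cancel dir_code dir_decode.
Proof. by case. Qed.

HB.instance Definition _ := Finite.copy dir (can_type dir_codeK).

Inductive letter := La | Lb | Lc | Ld | Le | Lf.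

Definition letter_code (x : letter) : bool * option bool :=
  match x with
  | La => (false, None) | Lb => (false, Some false) | Lc => (false, Some true)
  | Ld => (true, None) | Le => (true, Some false) | Lf => (true, Some true)
  end.

Definition letter_decode (p : bool * option bool) : letter :=
  match p with
  | (false, None) => La | (false, Some false) => Lb | (false, Some true) => Lc
  | (true, None) => Ld | (true, Some false) => Le | (true, Some true) => Lf
  end.

Lemma letter_codeK : cancel letter_code letter_decode.
Proof. by case. Qed.

HB.instance Definition _ := Finite.copy letter (can_type letter_codeK).

Definition dirs (x : letter) : {set dir} :=
  match x with
  | La => [set Right; Down]
  | Lb => [set Up; Down]
  | Lc => [set Right; Up]
  | Ld => [set Left; Down]
  | Le => [set Left; Right]
  | Lf => [set Left; Up]
  end.

Definition arc_ud : rel letter :=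
  fun x y => (Down \in dirs x) == (Up \in dirs y).

(* [ordS] is the cyclic successor, so the last letter is followed by the
   first one. *)
Definition VD (m : nat) : {set m.-tuple letter} :=
  [set x : m.-tuple letter |
    [forall i : 'I_m, arc_ud (tnth x i) (tnth x (ordS i))]].

Definition outlet (m : nat) (x : m.-tuple letter) : m.-tuple bool :=
  [tuple tnth x j \in [:: La; Lc; Le] | j < m].

Definition inlet (m : nat) (x : m.-tuple letter) : m.-tuple bool :=
  [tuple tnth x j \in [:: Ld; Le; Lf] | j < m].

Definition Vstar (m : nat) : {set m.-tuple bool} :=
  [set outlet x | x in VD m].

Definition arcs_star (m : nat) (v w : m.-tuple bool) : nat :=
  #|[set y in VD m | (inlet y == v) && (outlet y == w)]|.

(* [V] is the vertex set and [n u w] the number of arcs from [u] to [w] of a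
   directed multigraph; only arcs between elements of [V] count. *)
Definition underlying_adj (T : finType) (V : {set T}) (n : T -> T -> nat) :
    rel T :=
  fun u w => [&& u \in V, w \in V & (0 < n u w) || (0 < n w u)].

(* Meaningful for [x \in V]; empty otherwise. *)
Definition component (T : finType) (V : {set T}) (n : T -> T -> nat) (x : T) :
    {set T} :=
  [set y in V | connect (underlying_adj V n) x y].

Definition zero_word (m : nat) : m.-tuple bool := [tuple of nseq m false].

Lemma zero_word_Vstar (m : nat) : zero_word m \in Vstar m.
Proof.
apply/imsetP; exists [tuple of nseq m Lb].
  by rewrite inE; apply/forallP=> i; rewrite !tnth_nseq /arc_ud /= !inE.
by apply: eq_from_tnth=> i; rewrite tnth_mktuple !tnth_nseq.
Qed.

Definition Nstar (m : nat) : {set m.-tuple bool} :=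
  component (Vstar m) (@arcs_star m) (zero_word m).

Definition word_rev (m : nat) (v : m.-tuple bool) : m.-tuple bool :=
  [tuple of rev v].

Definition rho (m : nat) (v : m.-tuple bool) : m.-tuple bool :=
  [tuple of rot 1 v].

(* Main.v *)
(** Reindexing a word along [ordS] (rotation), or along [rev_ord] while exchanging
    up and down in every letter (reversal), maps vertices of D_m to vertices of
    D_m and transforms inlet and outlet words by the same reindexing. Each of the
    two operations thus induces an endomorphism of the multigraph D*_m fixing the
    word 0^m, and endomorphisms preserve connectedness to a fixed vertex. *)
Require Import Defs.
From mathcomp Require Import all_boot.

Set Implicit Arguments.
Unset Strict Implicit.
Unset Printing Implicit Defensive.

Lemma connect_homo (T T' : finType) (e : rel T) (e' : rel T') (f : T -> T') :
  {homo f : x y / e x y >-> e' x y} ->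
  {homo f : x y / connect e x y >-> connect e' x y}.
Proof.
move=> fh x _ /connectP[p pp ->]; apply/connectP; exists (map f p).
  exact: (homo_path fh).
by rewrite last_map.
Qed.

Lemma component_homo (T : finType) (V : {set T}) (n : T -> T -> nat)
    (f : T -> T) (x : T) :
  {homo f : u / u \in V} -> {homo f : u w / 0 < n u w} -> f x = x ->
  {homo f : u / u \in component V n x}.
Proof.
(* The base point is rewritten as [f x], so that both ends of the path sought are images under
   [f]. *)
move=> fV fn fx y; rewrite !inE => /andP[yV cxy]; rewrite fV //= -{1}fx.
apply: connect_homo cxy => u w /and3P[uV wV a]; apply/and3P; split; rewrite ?fV //.
by case/orP: a => /fn -> //; rewrite orbT.
Qed.

Definition reindex (m : nat) (T : Type) (s : 'I_m -> 'I_m) (v : m.-tuple T) :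
    m.-tuple T :=
  [tuple tnth v (s j) | j < m].

(** Recoding by [phi] changes no outlet or inlet bit, so a vertex witnessing an arc from [u] to [w]
    is sent to one witnessing an arc between the reindexed words; [0^m] is fixed because it is
    constant. *)
Lemma Nstar_reindex (m : nat) (s : 'I_m -> 'I_m) (phi : letter -> letter) :
  (forall l, (phi l \in [:: La; Lc; Le]) = (l \in [:: La; Lc; Le])) ->
  (forall l, (phi l \in [:: Ld; Le; Lf]) = (l \in [:: Ld; Le; Lf])) ->
  {homo (fun x : m.-tuple letter => reindex s (map_tuple phi x)) :
    x / x \in VD m} ->
  {homo reindex s : v / v \in Nstar m}.
Proof.
move=> phi_out phi_in gV.
pose g (x : m.-tuple letter) := reindex s (map_tuple phi x).
have outg x : outlet (g x) = reindex s (outlet x).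
  by apply: eq_from_tnth => i; rewrite !tnth_mktuple tnth_map phi_out.
have ing x : inlet (g x) = reindex s (inlet x).
  by apply: eq_from_tnth => i; rewrite !tnth_mktuple tnth_map phi_in.
apply: component_homo => [_ /imsetP[x xV ->] | u w | ].
- by rewrite -outg; apply: imset_f; apply: gV.
- case/card_gt0P=> x; rewrite inE => /and3P[xV /eqP <- /eqP <-].
  by apply/card_gt0P; exists (g x); rewrite inE ing outg !eqxx gV.
- by apply: eq_from_tnth => i; rewrite !tnth_mktuple !tnth_nseq.
Qed.

Lemma rhoE (m : nat) (v : m.-tuple bool) : rho v = reindex (@ordS m) v.
Proof.
case: m v => [|m] v; first by apply: eq_from_tnth => -[].
apply: eq_from_tnth => i; rewrite tnth_mktuple !(tnth_nth false) /=.
case: (tupleP v) => b t; rewrite /= rot1_cons nth_rcons size_tuple.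
have := ltn_ord i; rewrite ltnS leq_eqVlt => /orP[/eqP -> | im].
  (* At the last position [ordS] wraps around to 0, the head [b] that [rot 1] moved to the end. *)
  by rewrite ltnn eqxx modnn.
by rewrite im modn_small.
Qed.

Lemma word_revE (m : nat) (v : m.-tuple bool) :
  word_rev v = reindex (@rev_ord m) v.
Proof.
apply: eq_from_tnth => i; rewrite tnth_mktuple !(tnth_nth false) /=.
by rewrite nth_rev size_tuple.
Qed.

(** Reversal turns cyclic successors into cyclic predecessors. *)
Lemma ordS_rev_ordS (m : nat) (i : 'I_m) : ordS (rev_ord (ordS i)) = rev_ord i.
Proof.
case: m i => [[]//|m] i; apply: val_inj; rewrite /= subSS.
have := ltn_ord i; rewrite ltnS leq_eqVlt => /orP[/eqP -> | im].
  by rewrite modnn subn0 modnn subnn.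
by rewrite (@modn_small i.+1) // subSS subnSK // modn_small // ltnS leq_subr.
Qed.

Definition flip_ud (l : letter) : letter :=
  match l with
  | La => Lc | Lb => Lb | Lc => La | Ld => Lf | Le => Le | Lf => Ld
  end.

(** Reversing a word swaps neighbouring letters; exchanging up and down then swaps the two sides of
    the equivalence defining [arc_ud]. *)
Lemma arc_ud_flip (x y : letter) :
  arc_ud (flip_ud y) (flip_ud x) = arc_ud x y.
Proof. by case: x; case: y; rewrite /arc_ud /= !inE. Qed.

Lemma Nstar_rho (m : nat) (v : m.-tuple bool) :
  v \in Nstar m -> rho v \in Nstar m.
Proof.
rewrite rhoE; apply: (Nstar_reindex (phi := id)) => // x; rewrite !inE => /forallP xV.
(* The condition at [i] is that of [x] at [ordS i]. *)
by apply/forallP => i; rewrite !tnth_mktuple !tnth_map.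
Qed.

Lemma Nstar_rev (m : nat) (v : m.-tuple bool) :
  v \in Nstar m -> word_rev v \in Nstar m.
Proof.
rewrite word_revE; apply: (Nstar_reindex (phi := flip_ud)); try by case.
move=> x; rewrite !inE => /forallP xV; apply/forallP => i.
(* What remains is the condition of [x] at [rev_ord (ordS i)]. *)
by rewrite !tnth_mktuple !tnth_map arc_ud_flip -(ordS_rev_ordS i).
Qed.

Theorem theorem6 (m : nat) (hm : 1 <= m) (v : m.-tuple bool)
    (hv : v \in Nstar m) :
  word_rev v \in Nstar m /\
  (forall k : nat, 0 <= k <= m - 1 -> iter k (@rho m) v \in Nstar m).
Proof.
split=> [|k _]; first exact: Nstar_rev.
by elim: k => //= k; apply: Nstar_rho.
Qed.
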